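(* Let $g$ be a finite dimensional semi-simple complex Lie algebra with Killing form $\kappa$, let $N=\dim_{\mathbb{C}} g$, fix a basis of $g$ (so that $\operatorname{ad}: g\to \operatorname{End}_{\mathbb{C}}(g)\cong \mathfrak{gl}_N(\mathbb{C})$), and let $\Phi := \iota_N\circ(1\otimes \operatorname{ad}) : g[t,t^{-1}]\to \mathfrak{gl}_N[t,t^{-1}]\to \mathbf{gl}(\infty)$ be the extended adjoint representation. Then the universal extension $\widehat{g}$ of $g[t,t^{-1}]$ is the pull-back of $\widehat{\mathbf{gl}}(\infty)$ via $\Phi$; that is, for all $X=\sum_i t^i\otimes x_i$ and $Y=\sum_j t^j\otimes y_j$ in $g[t,t^{-1}]$, $$\mathrm{c}(\Phi(X),\Phi(Y)) = u(X,Y)=\sum_i i\,\kappa(x_i,y_{-i}).$$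
   Context: $g[t,t^{-1}]=\mathbb{C}[t,t^{-1}]\otimes_{\mathbb{C}} g$ is the loop algebra with bracket $[f\otimes x,h\otimes y]=fh\otimes[x,y]$. Its universal extension $\widehat{g}$ is the central extension $\mathbb{C}\oplus g[t,t^{-1}]$ defined by the 2-cocycle $u\left(\sum_i t^i\otimes x_i,\sum_j t^j\otimes y_j\right)=\sum_i i\,\kappa(x_i,y_{-i})$. $\mathbf{gl}(\infty)$ is the Lie algebra (commutator bracket) of $\mathbb{Z}\times\mathbb{Z}$ complex matrices $A=(a_{ij})$ with $a_{ij}=0$ for $|i-j|\gg 0$; $\mathrm{E}_{ij}$ denotes the matrix unit. The 2-cocycle $\mathrm{c}$ on $\mathbf{gl}(\infty)$ is $\mathrm{c}(A,B)=\sum_{i\le 0,k>0}a_{ik}b_{ki}-\sum_{i>0,k\le 0}a_{ik}b_{ki}$, and $\widehat{\mathbf{gl}}(\infty)=\mathbb{C}\oplus\mathbf{gl}(\infty)$ with bracket $[(a,x),(b,y)]=(\mathrm{c}(x,y),[x,y])$. For $N\ge1$, $\iota_N:\mathfrak{gl}_N[t,t^{-1}]=\mathbb{C}[t,t^{-1}]\otimes\mathfrak{gl}_N(\mathbb{C})\to\mathbf{gl}(\infty)$ is the Lie algebra monomorphism $t^m\otimes e_{ij}\mapsto\sum_{k\in\mathbb{Z}}\mathrm{E}_{N(k-m)+i,\,Nk+j}$ ($1\le i,j\le N$, $m\in\mathbb{Z}$), extended linearly, where $e_{ij}$ are the matrix units of $\mathfrak{gl}_N$; $1\otimes\operatorname{ad}$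 sends $t^m\otimes x\mapsto t^m\otimes\operatorname{ad}x$. *)

(* Defs.v *)
From HB Require Import structures.
From mathcomp Require Import all_boot all_order all_algebra.
From mathcomp Require Import zify ring.
From mathcomp Require Import all_classical.

Set Implicit Arguments.
Unset Strict Implicit.
Unset Printing Implicit Defensive.

Import Order.TTheory GRing.Theory Num.Theory.
Local Open Scope ring_scope.
Local Open Scope classical_set_scope.

HB.mixin Record Lmodule_isLieAlgebra (K : fieldType) V of GRing.Lmodule K V := {
  lie_br : V -> V -> V;
  lie_brl_linear : forall y, linear (lie_br^~ y);
  lie_brr_linear : forall x, linear (lie_br x);
  lie_brxx : forall x, lie_br x x = 0;
  lie_jacobi : forall x y z,
    lie_br x (lie_br y z) + lie_br y (lie_br z x) + lie_br z (lie_br x y) = 0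
}.

#[short(type="lieAlgType")]
HB.structure Definition LieAlgebra (K : fieldType) :=
  {V of GRing.Lmodule K V & Lmodule_isLieAlgebra K V}.

#[short(type="finLieAlgType")]
HB.structure Definition FinLieAlgebra (K : fieldType) :=
  {V of Vector K V & LieAlgebra K V}.

Notation "[ 'lie' x , y ]" := (lie_br x y) (at level 0,
  format "[ 'lie'  x ,  y ]") : ring_scope.

Section LieTheory.
Variables (K : fieldType) (L : lieAlgType K).
Implicit Types x y z : L.

HB.instance Definition _ x :=
  GRing.isLinear.Build K L L *:%R (lie_br x) (lie_brr_linear x).

Lemma lie_brDl x y z : [lie x + y, z] = [lie x, z] + [lie y, z].
Proof. by have := lie_brl_linear z 1 x y; rewrite !scale1r. Qed.

Lemma lie_br0l z : [lie 0, z] = 0 :> L.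
Proof. by apply: (addIr [lie 0, z]); rewrite -lie_brDl !add0r. Qed.

Lemma lie_brZl a x z : [lie a *: x, z] = a *: [lie x, z].
Proof. by rewrite -[a *: x]addr0 lie_brl_linear lie_br0l addr0. Qed.

Lemma lie_br0r z : [lie z, 0] = 0 :> L. Proof. exact: linear0. Qed.

Lemma lie_brC x y : [lie x, y] = - [lie y, x].
Proof.
apply/eqP; rewrite -addr_eq0; apply/eqP.
by have := lie_brxx (x + y); rewrite lie_brDl !linearD /= !lie_brxx add0r addr0.
Qed.

Lemma lie_br_suml I (r : seq I) (P : pred I) (F : I -> L) z :
  [lie \sum_(i <- r | P i) F i, z] = \sum_(i <- r | P i) [lie F i, z].
Proof.
by elim/big_rec2: _ => [|i a b _ <-]; rewrite ?lie_br0l ?lie_brDl.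
Qed.

End LieTheory.

Definition lie_hom (K : fieldType) (L L' : lieAlgType K) (f : L -> L') : Prop :=
  linear f /\ forall x y, f [lie x, y] = [lie f x, f y].

(* The square p1, p2, f1, f2 is cartesian in Lie algebras: (p1, p2) identifies
   P with the fibre product {(x, y) | f1 x = f2 y}. *)
Definition is_pullback (K : fieldType) (P L1 L2 L : lieAlgType K)
    (p1 : P -> L1) (p2 : P -> L2) (f1 : L1 -> L) (f2 : L2 -> L) : Prop :=
  [/\ lie_hom p1 /\ lie_hom p2,
      lie_hom f1 /\ lie_hom f2,
      forall z, f1 (p1 z) = f2 (p2 z)
    & forall x y, f1 x = f2 y -> exists! z, p1 z = x /\ p2 z = y].

Section FinLie.
Variables (K : fieldType) (g : finLieAlgType K).
Implicit Types (x y z : g) (U V I : {vspace g}).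

Definition lie_ideal I : Prop := forall x y, y \in I -> [lie x, y] \in I.

(* The span of all brackets of U with V; by bilinearity bases suffice, see
   mem_lie_brv. *)
Definition lie_brv U V : {vspace g} :=
  <<[seq [lie u, v] | u <- vbasis U, v <- vbasis V]>>%VS.

Lemma mem_lie_brv U V x y : x \in U -> y \in V -> [lie x, y] \in lie_brv U V.
Proof.
move=> xU yV; rewrite (coord_vbasis xU) (coord_vbasis yV).
rewrite lie_br_suml memv_suml // => i _.
rewrite linear_sum memv_suml // => j _.
rewrite /= lie_brZl linearZ /= !memvZ // memv_span //.
by apply/allpairsP; exists ((vbasis U)`_i, (vbasis V)`_j);
  rewrite /= !mem_nth ?size_tuple.
Qed.

Definition lie_derived n U : {vspace g} := iter n (fun W => lie_brv W W) U.

Definition lie_solvable U : Prop := exists n, lie_derived n U = 0%VS.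

Definition semisimple : Prop :=
  forall I, lie_ideal I -> lie_solvable I -> I = 0%VS.

Definition ad x : 'End(g) := linfun (lie_br x).

(* The identification of End(g) with gl_N given by a basis b; columns are the
   images of the basis vectors, so that it is multiplicative. *)
Definition end_mx N (b : N.-tuple g) (f : 'End(g)) : 'M[K]_N :=
  \matrix_(i, j) coord b i (f b`_j).

Lemma end_mx_linear N (b : N.-tuple g) : linear (end_mx b).
Proof.
move=> a f h; apply/matrixP=> i j.
by rewrite !mxE add_lfunE scale_lfunE linearP.
Qed.

HB.instance Definition _ N (b : N.-tuple g) :=
  GRing.isLinear.Build K 'End(g) 'M[K]_N *:%R (end_mx b) (end_mx_linear b).

Lemma end_mx_comp N (b : N.-tuple g) (f h : 'End(g)) : basis_of {:g} b ->
  end_mx b (f \o h)%VF = end_mx b f *m end_mx b h.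
Proof.
move=> bb; apply/matrixP=> i j; rewrite !mxE comp_lfunE.
rewrite [h _](coord_basis bb) ?memvf // !linear_sum /=.
by apply: eq_bigr => k _; rewrite !mxE !linearZ /= mulrC.
Qed.

Definition lfun_trace (f : 'End(g)) : K := \tr (end_mx (vbasis {:g}) f).

Definition killing x y : K := lfun_trace (ad x \o ad y)%VF.

Lemma ad_linear : linear ad.
Proof.
move=> a x y; apply/lfunP=> z.
by rewrite add_lfunE scale_lfunE !lfunE /= lie_brl_linear.
Qed.

HB.instance Definition _ :=
  GRing.isLinear.Build K g 'End(g) *:%R ad ad_linear.

Definition ad_mx N (b : N.-tuple g) x : 'M[K]_N := end_mx b (ad x).

Lemma ad_mx_linear N (b : N.-tuple g) : linear (ad_mx b).
Proof. by move=> a x y; rewrite /ad_mx !linearP. Qed.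

HB.instance Definition _ N (b : N.-tuple g) :=
  GRing.isLinear.Build K g 'M[K]_N *:%R (ad_mx b) (ad_mx_linear b).

Lemma killingE x y : killing x y =
  \tr (end_mx (vbasis {:g}) (ad x) *m end_mx (vbasis {:g}) (ad y)).
Proof. by rewrite /killing /lfun_trace end_mx_comp ?vbasisP. Qed.

Lemma killing_linear x : scalar (killing x).
Proof.
by move=> a y z; rewrite !killingE !linearP.
Qed.

HB.instance Definition _ x :=
  GRing.isLinear.Build K g K *%R (killing x) (killing_linear x).

Lemma killingC x y : killing x y = killing y x.
Proof. by rewrite !killingE mxtrace_mulC. Qed.

Lemma killing_br x y z : killing [lie x, y] z = killing [lie y, z] x.
Proof.
have adB u v : ad [lie u, v] = (ad u \o ad v)%VF - (ad v \o ad u)%VF.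
  apply/lfunP=> w; rewrite add_lfunE opp_lfunE !comp_lfunE !lfunE /=.
  rewrite [LHS]lie_brC [lie_br u w]lie_brC linearN opprK.
  by apply/esym/eqP; rewrite -subr_eq0 opprK lie_jacobi.
rewrite !killingE !adB.
rewrite !linearB /= !end_mx_comp ?vbasisP // !mulmxBl !linearB /=.
by congr (_ - _); [rewrite -mulmxA mxtrace_mulC | rewrite mxtrace_mulC mulmxA].
Qed.

End FinLie.

Definition win (M : nat) : seq int :=
  [seq i%:Z - M%:Z | i <- iota 0 M.*2.+1].

Lemma mem_win M k : (k \in win M) = (`|k| <= M)%N.
Proof.
apply/mapP/idP => [[i + ->]|kM]; first by rewrite mem_iota; lia.
by exists (absz (k + M%:Z)); rewrite ?mem_iota; lia.
Qed.

Lemma win_uniq M : uniq (win M).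
Proof. by rewrite map_inj_uniq ?iota_uniq // => i j; lia. Qed.

Lemma fsum_win (V : nmodType) M (D : set int) (F : int -> V) :
  (forall i, D i -> (M < `|i|)%N -> F i = 0) ->
  \sum_(i \in D) F i = \sum_(i <- win M | i \in D) F i.
Proof.
move=> F0; rewrite [RHS]bigfs ?win_uniq ?set_mem_set // => i.
by rewrite inE mem_win -ltnNge; apply: F0.
Qed.

Lemma fsumT_win (V : nmodType) M (F : int -> V) :
  (forall i, (M < `|i|)%N -> F i = 0) ->
  \sum_(i \in [set: int]) F i = \sum_(i <- win M) F i.
Proof.
by move=> F0; rewrite (@fsum_win _ M) => [|i _ /F0//]; under eq_bigl do rewrite in_setT.
Qed.

Lemma big_win1 (V : nmodType) M (F : int -> V) (P : pred int) k :
  (forall i, P i = (i == k)) -> ((M < `|k|)%N -> F k = 0) ->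
  \sum_(i <- win M | P i) F i = F k.
Proof.
move=> Pk F0; rewrite (eq_bigl (pred1 k)) //.
have [kM|] := boolP (k \in win M).
  by rewrite -big_filter filter_pred1_uniq ?win_uniq // big_seq1.
move=> kM; rewrite F0; last by move: kM; rewrite mem_win -ltnNge.
rewrite big_seq_cond big1 // => i /andP[iM /eqP ik].
by move: kM; rewrite -ik iM.
Qed.

Lemma big_alternating (V : zmodType) (I : eqType) (s : seq I) (F : I -> I -> V) :
  (forall i, F i i = 0) -> (forall i j, F i j = - F j i) ->
  \sum_(i <- s) \sum_(j <- s) F i j = 0.
Proof.
move=> F0 FN; elim: s => [|x s IH]; first by rewrite big_nil.
rewrite big_cons big_cons F0 add0r.
under [X in _ + X]eq_bigr do rewrite big_cons.
rewrite big_split /= IH addr0 -big_split big1 // => j _.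
by rewrite /= [F j x]FN subrr.
Qed.

Lemma big_cycle (V : nmodType) (I : Type) (s : seq I) (F : I -> I -> I -> V) :
  \sum_(i <- s) \sum_(j <- s) \sum_(k <- s) F i j k =
  \sum_(i <- s) \sum_(j <- s) \sum_(k <- s) F j k i.
Proof.
by rewrite [RHS]exchange_big; apply: eq_bigr => i _; rewrite exchange_big.
Qed.

Lemma big_cycle3 (V : nmodType) (I : Type) (s : seq I) (F G H : I -> I -> I -> V) :
  (forall i j k, F i j k + G j k i + H k i j = 0) ->
  \sum_(i <- s) \sum_(j <- s) \sum_(k <- s) F i j k +
  \sum_(i <- s) \sum_(j <- s) \sum_(k <- s) G i j k +
  \sum_(i <- s) \sum_(j <- s) \sum_(k <- s) H i j k = 0.
Proof.
move=> FGH; rewrite [X in _ + X + _]big_cycle [X in _ + _ + X]big_cycle.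
rewrite [X in _ + _ + X]big_cycle -!big_split big1 // => i _.
rewrite -!big_split big1 // => j _.
by rewrite -!big_split big1 // => k _; exact: FGH.
Qed.

(* An element sum_i t^i (x) x_i of V[t, t^-1] is encoded by the family (x_i);
   a subset of int is finite iff it is bounded. *)
Definition laurent (K : fieldType) (V : lmodType K) : {pred int -> V} :=
  [pred X | `[< exists M : nat, forall i, (M < `|i|)%N -> X i = 0 >]].

Lemma laurent_submod_closed (K : fieldType) (V : lmodType K) :
  submod_closed (@laurent K V).
Proof.
split=> [|a X Y /asboolP[m Xm] /asboolP[n Yn]]; apply/asboolP; first by exists 0%N.
exists (m + n)%N => i imn; rewrite -[LHS]/(a *: X i + Y i).
by rewrite Xm ?Yn ?scaler0 ?addr0 //; lia.
Qed.

HB.instance Definition _ (K : fieldType) (V : lmodType K) :=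
  GRing.isSubmodClosed.Build K (int -> V) (@laurent K V) (@laurent_submod_closed K V).

Record loop (K : fieldType) (V : lmodType K) := Loop {
  loop_val :> int -> V;
  loop_valP : loop_val \in @laurent K V }.

Section LoopModule.
Variables (K : fieldType) (V : lmodType K).
HB.instance Definition _ := [isSub for @loop_val K V].
HB.instance Definition _ := [Choice of loop V by <:].
HB.instance Definition _ := [SubChoice_isSubLmodule of loop V by <:].

Lemma loop_bound (X : loop V) : exists M : nat, forall i, (M < `|i|)%N -> X i = 0.
Proof. exact/asboolP/(loop_valP X). Qed.

Lemma loopP (X Y : loop V) : X =1 Y -> X = Y.
Proof. by move=> XY; apply: val_inj; apply: funext. Qed.

Lemma loopDE (X Y : loop V) i : (X + Y) i = X i + Y i. Proof. by []. Qed.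
Lemma loopZE a (X : loop V) i : (a *: X) i = a *: X i. Proof. by []. Qed.
Lemma loop0E i : (0 : loop V) i = 0. Proof. by []. Qed.
End LoopModule.

Section LoopMap.
Variables (K : fieldType) (V W : lmodType K) (f : {linear V -> W}).

Fact loop_map_subproof (X : loop V) : (fun i => f (X i)) \in @laurent K W.
Proof.
have [M XM] := loop_bound X.
by apply/asboolP; exists M => i /XM ->; rewrite linear0.
Qed.

(* 1 (x) f on C[t, t^-1] (x) V *)
Definition loop_map (X : loop V) : loop W := Loop (loop_map_subproof X).

End LoopMap.

Section LoopAlgebra.
Variables (K : fieldType) (L : lieAlgType K).
Implicit Types X Y Z : loop L.

Definition loop_br_fun X Y (n : int) : L :=
  \sum_(i \in [set: int]) [lie X i, Y (n - i)].

Lemma loop_br_win M X Y n : (forall i, (M < `|i|)%N -> X i = 0) ->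
  loop_br_fun X Y n = \sum_(i <- win M) [lie X i, Y (n - i)].
Proof. by move=> XM; rewrite /loop_br_fun (@fsumT_win _ M) // => i /XM ->; exact: lie_br0l. Qed.

Lemma loop_br_win2 M X Y n : (forall i, (M < `|i|)%N -> X i = 0) ->
  (forall i, (M < `|i|)%N -> Y i = 0) ->
  loop_br_fun X Y n =
  \sum_(i <- win M) \sum_(j <- win M | i + j == n) [lie X i, Y j].
Proof.
move=> XM YM; rewrite (loop_br_win _ _ XM); apply: eq_bigr => i _.
rewrite (@big_win1 _ _ _ _ (n - i)) // => [j|/YM ->]; last exact: lie_br0r.
by rewrite [RHS]eq_sym subr_eq eq_sym addrC.
Qed.

Fact loop_br_subproof X Y : loop_br_fun X Y \in @laurent K L.
Proof.
have [m Xm] := loop_bound X; have [n Yn] := loop_bound Y.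
apply/asboolP; exists (m + n)%N => i imn; rewrite /loop_br_fun fsbig1 // => j _.
have [/Xm ->|jm] := ltnP m `|j|; first exact: lie_br0l.
by rewrite Yn ?lie_br0r //; lia.
Qed.

(* [t^i (x) x, t^j (x) y] = t^(i + j) (x) [x, y] *)
Definition loop_br X Y : loop L := Loop (loop_br_subproof X Y).

Fact loop_brl_linear Y : linear (loop_br^~ Y).
Proof.
move=> a X X'; apply: loopP => n; rewrite loopDE loopZE /=.
have [m Xm] := loop_bound X; have [m' Xm'] := loop_bound X'.
have [m2 Xm2] := loop_bound (a *: X + X').
set M := (m + m' + m2)%N.
rewrite !(@loop_br_win M); do ?by move=> i iM; rewrite (Xm, Xm', Xm2) //; lia.
by rewrite scaler_sumr -big_split; apply: eq_bigr => i _; exact: lie_brl_linear.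
Qed.

Fact loop_brr_linear X : linear (loop_br X).
Proof.
move=> a Y Y'; apply: loopP => n; rewrite loopDE loopZE /=.
have [m Xm] := loop_bound X; rewrite !(loop_br_win _ _ Xm).
by rewrite scaler_sumr -big_split; apply: eq_bigr => i _; exact: lie_brr_linear.
Qed.

Fact loop_brxx X : loop_br X X = 0.
Proof.
apply: loopP => n; have [m Xm] := loop_bound X.
rewrite loop0E /= (loop_br_win2 _ Xm Xm).
under eq_bigr do rewrite big_mkcond.
apply: (@big_alternating _ _ _
    (fun i j => if i + j == n then [lie X i, X j] else 0)) => [i|i j].
  by case: ifP; rewrite ?lie_brxx.
by rewrite addrC; case: ifP; rewrite ?oppr0 // lie_brC.
Qed.

Lemma loop_br3_win M X Y Z n : (forall i, (M < `|i|)%N -> X i = 0) ->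
  (forall i, (M < `|i|)%N -> Y i = 0) -> (forall i, (M < `|i|)%N -> Z i = 0) ->
  loop_br X (loop_br Y Z) n = \sum_(i <- win M) \sum_(j <- win M) \sum_(k <- win M)
    if i + j + k == n then [lie X i, [lie Y j, Z k] ] else 0.
Proof.
move=> XM YM ZM; rewrite /= (loop_br_win _ _ XM); apply: eq_bigr => i _ /=.
rewrite (loop_br_win2 _ YM ZM) linear_sum; apply: eq_bigr => j _ /=.
rewrite linear_sum -big_mkcond /=; apply: eq_bigl => k.
by rewrite eq_sym subr_eq eq_sym addrC addrA.
Qed.

Fact loop_jacobi X Y Z :
  loop_br X (loop_br Y Z) + loop_br Y (loop_br Z X) + loop_br Z (loop_br X Y) = 0.
Proof.
apply: loopP => n; rewrite !loopDE loop0E.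
have [m1 Xm] := loop_bound X; have [m2 Ym] := loop_bound Y.
have [m3 Zm] := loop_bound Z; set M := (m1 + m2 + m3)%N.
rewrite !(@loop_br3_win M); do ?by move=> i iM; rewrite (Xm, Ym, Zm) //; lia.
apply: big_cycle3 => i j k.
have -> : j + k + i = i + j + k by lia.
have -> : k + i + j = i + j + k by lia.
by case: ifP; rewrite ?addr0 ?lie_jacobi.
Qed.

HB.instance Definition _ := Lmodule_isLieAlgebra.Build K (loop L)
  loop_brl_linear loop_brr_linear loop_brxx loop_jacobi.

End LoopAlgebra.

Record cocycle2 (K : fieldType) (L : lieAlgType K) := Cocycle2 {
  cocycle_val :> L -> L -> K;
  cocycle_linearl : forall y, scalar (cocycle_val^~ y);
  cocycle_linearr : forall x, scalar (cocycle_val x);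
  cocyclexx : forall x, cocycle_val x x = 0;
  cocycle_jacobi : forall x y z,
    cocycle_val x [lie y, z] + cocycle_val y [lie z, x] +
    cocycle_val z [lie x, y] = 0 }.

Definition central_ext (K : fieldType) (L : lieAlgType K) (w : cocycle2 L) : Type :=
  (K^o * L)%type.

Section CentralExtension.
Variables (K : fieldType) (L : lieAlgType K) (w : cocycle2 L).

HB.instance Definition _ := GRing.Lmodule.on (central_ext w).

Definition central_br (p q : central_ext w) : central_ext w :=
  (w p.2 q.2, [lie p.2, q.2]).

Lemma central_ext_eq (p q : central_ext w) : p.1 = q.1 -> p.2 = q.2 -> p = q.
Proof. by case: p q => [a x] [b y] /= -> ->. Qed.

Fact central_brl_linear q : linear (central_br^~ q).
Proof.
move=> a p p'; apply: central_ext_eq; last exact: lie_brl_linear.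
exact: (cocycle_linearl w q.2 a p.2 p'.2).
Qed.

Fact central_brr_linear p : linear (central_br p).
Proof.
move=> a q q'; apply: central_ext_eq; last exact: lie_brr_linear.
exact: (cocycle_linearr w p.2 a q.2 q'.2).
Qed.

Fact central_brxx p : central_br p p = 0.
Proof. by apply: central_ext_eq; [exact: (cocyclexx w p.2) | exact: lie_brxx]. Qed.

Fact central_jacobi p q r : central_br p (central_br q r) +
  central_br q (central_br r p) + central_br r (central_br p q) = 0.
Proof.
apply: central_ext_eq; last exact: lie_jacobi.
exact: (cocycle_jacobi w p.2 q.2 r.2).
Qed.

HB.instance Definition _ := Lmodule_isLieAlgebra.Build K (central_ext w)
  central_brl_linear central_brr_linear central_brxx central_jacobi.

End CentralExtension.

Section UniversalExtension.
Variables (K : fieldType) (g : finLieAlgType K).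
Implicit Types X Y Z : loop g.

Definition loop_u X Y : K := \sum_(i \in [set: int]) i%:~R * killing (X i) (Y (- i)).

Lemma killing0l (x : g) : killing 0 x = 0.
Proof. by rewrite killingC linear0. Qed.

Lemma loop_u_win M X Y : (forall i, (M < `|i|)%N -> X i = 0) ->
  loop_u X Y = \sum_(i <- win M) i%:~R * killing (X i) (Y (- i)).
Proof. by move=> XM; apply: fsumT_win => i /XM ->; rewrite killing0l mulr0. Qed.

Fact loop_u_linearr X : scalar (loop_u X).
Proof.
move=> a Y Y'; have [m Xm] := loop_bound X; rewrite !(loop_u_win _ Xm).
rewrite mulr_sumr -big_split; apply: eq_bigr => i _.
by rewrite loopDE loopZE linearP mulrDr mulrCA.
Qed.

Fact loop_u_linearl Y : scalar (loop_u^~ Y).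
Proof.
move=> a X X'; have [m Xm] := loop_bound X; have [m' Xm'] := loop_bound X'.
have [m2 Xm2] := loop_bound (a *: X + X').
rewrite /= !(@loop_u_win (m + m' + m2)); do ?by move=> i iM; rewrite (Xm, Xm', Xm2) //; lia.
rewrite mulr_sumr -big_split; apply: eq_bigr => i _.
by rewrite loopDE loopZE !(killingC _ (Y _)) linearP mulrDr mulrCA.
Qed.

Fact loop_uxx X : loop_u X X = 0.
Proof.
have [m Xm] := loop_bound X; rewrite (loop_u_win _ Xm).
pose F (i j : int) : K := if i + j == 0 then i%:~R * killing (X i) (X j) else 0.
rewrite -[RHS](@big_alternating K _ (win m) F) => [|i|i j].
- apply: eq_bigr => i _; rewrite /F -big_mkcond.
  apply/esym; apply: (big_win1 (F := fun j => _ * killing (X i) (X j))).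
    by move=> j; rewrite addrC addr_eq0.
  by move=> /Xm ->; rewrite linear0 mulr0.
- rewrite /F; case: eqP => // ii; have -> : i = 0 by lia.
  by rewrite mul0r.
rewrite /F addrC; case: eqP => [ji|]; last by rewrite oppr0.
have -> : i = - j by lia.
by rewrite killingC mulrNz mulNr.
Qed.

Lemma loop_u_br_win M X Y Z : (forall i, (M < `|i|)%N -> X i = 0) ->
  (forall i, (M < `|i|)%N -> Y i = 0) -> (forall i, (M < `|i|)%N -> Z i = 0) ->
  loop_u X [lie Y, Z] = \sum_(i <- win M) \sum_(j <- win M) \sum_(k <- win M)
    if i + j + k == 0 then i%:~R * killing (X i) [lie Y j, Z k] else 0.
Proof.
move=> XM YM ZM; rewrite (loop_u_win _ XM); apply: eq_bigr => i _ /=.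
rewrite (loop_br_win2 _ YM ZM) linear_sum mulr_sumr; apply: eq_bigr => j _ /=.
rewrite linear_sum mulr_sumr -big_mkcond /=; apply: eq_bigl => k.
by rewrite -addr_eq0 addrC addrA.
Qed.

Fact loop_u_jacobi X Y Z :
  loop_u X [lie Y, Z] + loop_u Y [lie Z, X] + loop_u Z [lie X, Y] = 0.
Proof.
have [m1 Xm] := loop_bound X; have [m2 Ym] := loop_bound Y.
have [m3 Zm] := loop_bound Z; set M := (m1 + m2 + m3)%N.
rewrite !(@loop_u_br_win M); do ?by move=> i iM; rewrite (Xm, Ym, Zm) //; lia.
apply: big_cycle3 => i j k.
have -> : j + k + i = i + j + k by lia.
have -> : k + i + j = i + j + k by lia.
case: eqP => [ijk|]; last by rewrite !addr0.
have -> : killing (X i) [lie Y j, Z k] = killing (Z k) [lie X i, Y j].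
  by rewrite killingC 2!killing_br killingC.
have -> : killing (Y j) [lie Z k, X i] = killing (Z k) [lie X i, Y j].
  by rewrite killingC killing_br killingC.
by rewrite -!mulrDl -!intrD ijk mul0r.
Qed.

Definition u_cocycle : cocycle2 (loop g) :=
  Cocycle2 loop_u_linearl loop_u_linearr loop_uxx loop_u_jacobi.

Definition hat_loop : lieAlgType K := central_ext u_cocycle.

End UniversalExtension.

Definition banded (K : fieldType) : {pred int -> int -> K^o} :=
  [pred A | `[< exists n : nat, forall i j, (n < `|i - j|)%N -> A i j = 0 >]].

Lemma banded_submod_closed (K : fieldType) : submod_closed (@banded K).
Proof.
split=> [|a A B /asboolP[m Am] /asboolP[n Bn]]; apply/asboolP; first by exists 0%N.
exists (m + n)%N => i j ijmn; rewrite -[LHS]/(a *: A i j + B i j).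
by rewrite Am ?Bn ?scaler0 ?addr0 //; lia.
Qed.

HB.instance Definition _ (K : fieldType) :=
  GRing.isSubmodClosed.Build K (int -> int -> K^o) (@banded K)
    (@banded_submod_closed K).

Record glinf (K : fieldType) := GLinf {
  glinf_val : int -> int -> K^o;
  glinf_valP : glinf_val \in @banded K }.

Definition glinf_entry (K : fieldType) (A : glinf K) (i j : int) : K :=
  glinf_val A i j.
Coercion glinf_entry : glinf >-> Funclass.

Section GLinf.
Variable K : fieldType.
Implicit Types A B C : glinf K.

HB.instance Definition _ := [isSub for @glinf_val K].
HB.instance Definition _ := [Choice of glinf K by <:].
HB.instance Definition _ := [SubChoice_isSubLmodule of glinf K by <:].

Lemma glinf_bound A : exists n : nat, forall i j, (n < `|i - j|)%N -> A i j = 0.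
Proof. exact/asboolP/(glinf_valP A). Qed.

Lemma glinfP A B : (forall i j, A i j = B i j) -> A = B.
Proof. by move=> AB; apply: val_inj; do 2!apply: funext => ?; exact: AB. Qed.

Lemma glinfDE A B i j : (A + B) i j = A i j + B i j. Proof. by []. Qed.
Lemma glinfNE A i j : (- A) i j = - A i j. Proof. by []. Qed.
Lemma glinfZE a A i j : (a *: A) i j = a * A i j. Proof. by []. Qed.
Lemma glinf0E i j : (0 : glinf K) i j = 0. Proof. by []. Qed.

Definition glinf_mul_fun A B (i k : int) : K :=
  \sum_(j \in [set: int]) A i j * B j k.

Fact glinf_mul_subproof A B : (glinf_mul_fun A B : int -> int -> K^o) \in @banded K.
Proof.
have [m Am] := glinf_bound A; have [n Bn] := glinf_bound B.
apply/asboolP; exists (m + n)%N => i k ik.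
rewrite /glinf_mul_fun fsbig1 // => j _.
have [/Am ->|ij] := ltnP m `|i - j|; first by rewrite mul0r.
by rewrite Bn ?mulr0 //; lia.
Qed.

Definition glinf_mul A B : glinf K := GLinf (glinf_mul_subproof A B).

Lemma glinf_mul_win n M A B i k : (forall i j, (n < `|i - j|)%N -> A i j = 0) ->
  (`|i| + n <= M)%N ->
  glinf_mul A B i k = \sum_(j <- win M) A i j * B j k.
Proof.
move=> An iM; apply: (@fsumT_win K) => j jM.
by rewrite An ?mul0r //; lia.
Qed.

Lemma glinf_mulDl A A' B i k :
  glinf_mul (A + A') B i k = glinf_mul A B i k + glinf_mul A' B i k.
Proof.
have [m Am] := glinf_bound A; have [m' Am'] := glinf_bound A'.
have [m2 Am2] := glinf_bound (A + A').
rewrite (@glinf_mul_win m (`|i| + m + m' + m2) A) ?(@glinf_mul_win m' (`|i| + m + m' + m2) A')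
  ?(@glinf_mul_win m2 (`|i| + m + m' + m2) (A + A')) //; try lia.
by rewrite -big_split; apply: eq_bigr => j _; rewrite glinfDE mulrDl.
Qed.

Lemma glinf_mulZl a A B i k : glinf_mul (a *: A) B i k = a * glinf_mul A B i k.
Proof.
have [m Am] := glinf_bound A; have [m2 Am2] := glinf_bound (a *: A).
rewrite (@glinf_mul_win m (`|i| + m + m2) A) ?(@glinf_mul_win m2 (`|i| + m + m2) (a *: A)) //;
  try lia.
by rewrite mulr_sumr; apply: eq_bigr => j _; rewrite glinfZE mulrA.
Qed.

Lemma glinf_mulDr A B B' i k :
  glinf_mul A (B + B') i k = glinf_mul A B i k + glinf_mul A B' i k.
Proof.
have [m Am] := glinf_bound A; rewrite !(glinf_mul_win _ _ Am (leqnn _)).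
by rewrite -big_split; apply: eq_bigr => j _; rewrite glinfDE mulrDr.
Qed.

Lemma glinf_mulZr a A B i k : glinf_mul A (a *: B) i k = a * glinf_mul A B i k.
Proof.
have [m Am] := glinf_bound A; rewrite !(glinf_mul_win _ _ Am (leqnn _)).
by rewrite mulr_sumr; apply: eq_bigr => j _; rewrite glinfZE mulrCA.
Qed.

Lemma glinf_mulNr A B i k : glinf_mul A (- B) i k = - glinf_mul A B i k.
Proof. by rewrite -scaleN1r glinf_mulZr mulN1r. Qed.

Lemma glinf_mulNl A B i k : glinf_mul (- A) B i k = - glinf_mul A B i k.
Proof. by rewrite -scaleN1r glinf_mulZl mulN1r. Qed.

Lemma glinf_mulA A B C : glinf_mul A (glinf_mul B C) = glinf_mul (glinf_mul A B) C.
Proof.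
apply: glinfP => i l; have [a Aa] := glinf_bound A; have [b Bb] := glinf_bound B.
have [d ABd] := glinf_bound (glinf_mul A B).
set M := (`|i| + a + b + d)%N.
rewrite (@glinf_mul_win a M A) ?(@glinf_mul_win d M (glinf_mul A B)) //; try lia.
rewrite [RHS](eq_bigr (fun k => (\sum_(j <- win M) A i j * B j k) * C k l));
  last by move=> k _; rewrite (@glinf_mul_win a M A) //; lia.
rewrite (eq_bigr (fun j => \sum_(k <- win M) A i j * (B j k * C k l))) => [|j _].
  rewrite exchange_big; apply: eq_bigr => k _ /=.
  by rewrite mulr_suml; apply: eq_bigr => j _; rewrite mulrA.
rewrite -mulr_sumr; have [/Aa ->|ij] := ltnP a `|i - j|; first by rewrite !mul0r.
by rewrite (@glinf_mul_win b M B) //; lia.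
Qed.

Definition glinf_br A B : glinf K := glinf_mul A B - glinf_mul B A.

Lemma glinf_brE A B i k :
  glinf_br A B i k = glinf_mul A B i k - glinf_mul B A i k.
Proof. by []. Qed.

Fact glinf_brl_linear B : linear (glinf_br^~ B).
Proof.
move=> a A A'; apply: glinfP => i k.
change (glinf_mul (a *: A + A') B i k - glinf_mul B (a *: A + A') i k =
  a * (glinf_mul A B i k - glinf_mul B A i k) +
  (glinf_mul A' B i k - glinf_mul B A' i k)).
rewrite (glinf_mulDl (a *: A) A') (glinf_mulDr B (a *: A) A').
rewrite (glinf_mulZl a A B) (glinf_mulZr a B A).
ring.
Qed.

Fact glinf_brr_linear A : linear (glinf_br A).
Proof.
move=> a B B'; apply: glinfP => i k.
change (glinf_mul A (a *: B + B') i k - glinf_mul (a *: B + B') A i k =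
  a * (glinf_mul A B i k - glinf_mul B A i k) +
  (glinf_mul A B' i k - glinf_mul B' A i k)).
rewrite (glinf_mulDl (a *: B) B') (glinf_mulDr A (a *: B) B').
rewrite (glinf_mulZl a B A) (glinf_mulZr a A B).
ring.
Qed.

Fact glinf_brxx A : glinf_br A A = 0.
Proof. by apply: glinfP => i k; rewrite glinf_brE subrr. Qed.

Lemma glinf_br_brE A B C i k : glinf_br A (glinf_br B C) i k =
  glinf_mul (glinf_mul A B) C i k - glinf_mul (glinf_mul A C) B i k -
  (glinf_mul (glinf_mul B C) A i k - glinf_mul (glinf_mul C B) A i k).
Proof.
transitivity (glinf_mul A (glinf_mul B C + - glinf_mul C B) i k -
  glinf_mul (glinf_mul B C + - glinf_mul C B) A i k); first by [].
rewrite (glinf_mulDl (glinf_mul B C) (- glinf_mul C B)).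
rewrite (glinf_mulDr A (glinf_mul B C) (- glinf_mul C B)).
rewrite (glinf_mulNl (glinf_mul C B) A) (glinf_mulNr A (glinf_mul C B)).
by rewrite (glinf_mulA A B C) (glinf_mulA A C B).
Qed.

Fact glinf_jacobi A B C :
  glinf_br A (glinf_br B C) + glinf_br B (glinf_br C A) + glinf_br C (glinf_br A B) = 0.
Proof.
apply: glinfP => i k.
change (glinf_br A (glinf_br B C) i k + glinf_br B (glinf_br C A) i k +
  glinf_br C (glinf_br A B) i k = 0).
rewrite (glinf_br_brE A B C) (glinf_br_brE B C A) (glinf_br_brE C A B).
ring.
Qed.

HB.instance Definition _ := Lmodule_isLieAlgebra.Build K (glinf K)
  glinf_brl_linear glinf_brr_linear glinf_brxx glinf_jacobi.

(* For banded A and B only finitely many terms are nonzero, so that these sums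
   do not fall in the default case (infinite support) of \sum_(_ \in _). *)
Definition glinf_c A B : K :=
  \sum_(i \in [set i : int | i <= 0]) \sum_(k \in [set k : int | 0 < k])
    A i k * B k i -
  \sum_(i \in [set i : int | 0 < i]) \sum_(k \in [set k : int | k <= 0])
    A i k * B k i.

Definition chi (i : int) : K := (i <= 0)%R%:R.

Lemma glinf_c_win n M A B : (forall i j, (n < `|i - j|)%N -> A i j = 0) ->
  (n <= M)%N ->
  glinf_c A B = \sum_(i <- win M) \sum_(k <- win M)
    (chi i - chi k) * (A i k * B k i).
Proof.
move=> An nM; pose D1 := [set i : int | i <= 0]; pose D2 := [set i : int | 0 < i].
have memD1 i : (i \in D1) = (i <= 0) by rewrite /D1; apply/idP/idP; rewrite inE.
have memD2 i : (i \in D2) = (0 < i) by rewrite /D2; apply/idP/idP; rewrite inE.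
have F0 (i k : int) : (M < `|i|)%N || (M < `|k|)%N ->
    D1 i /\ D2 k \/ D2 i /\ D1 k -> A i k * B k i = 0.
  by rewrite /D1 /D2 /= => ik iDk; rewrite An ?mul0r //; lia.
rewrite /glinf_c -/D1 -/D2 !(@fsum_win _ M); first last.
- by move=> i i0 iM; rewrite fsbig1 // => k k0; apply: F0; [rewrite iM | left].
- by move=> i i0 iM; rewrite fsbig1 // => k k0; apply: F0; [rewrite iM | right].
rewrite big_mkcond [X in _ - X]big_mkcond -sumrB; apply: eq_bigr => i _.
rewrite memD1 memD2 /chi; case: (lerP i 0) => i0; rewrite ?subr0 ?sub0r.
- rewrite (@fsum_win _ M) => [|k k0 kM].
    rewrite big_mkcond; apply: eq_bigr => k _; rewrite memD2.
    by case: (lerP k 0) => k0 /=; rewrite ?subrr ?mul0r // subr0 mul1r.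
  by apply: F0; [rewrite kM orbT | left].
rewrite (@fsum_win _ M) => [|k k0 kM].
  rewrite big_mkcond -sumrN; apply: eq_bigr => k _; rewrite memD1.
  by case: (lerP k 0) => k0 /=; rewrite ?subrr ?mul0r ?oppr0 // sub0r mulN1r.
by apply: F0; [rewrite kM orbT | right].
Qed.

Fact glinf_c_linearl B : scalar (glinf_c^~ B).
Proof.
move=> a A A'; have [m Am] := glinf_bound A; have [m' Am'] := glinf_bound A'.
have [m2 Am2] := glinf_bound (a *: A + A').
pose M := (m + m' + m2)%N.
rewrite (@glinf_c_win m M A) ?(@glinf_c_win m' M A') ?(@glinf_c_win m2 M (a *: A + A')) //;
  try lia.
rewrite mulr_sumr -big_split; apply: eq_bigr => i _.
rewrite mulr_sumr -big_split; apply: eq_bigr => k _.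
have -> : (a *: A + A') i k = a * A i k + A' i k by [].
rewrite -[RHS]/(a * ((chi i - chi k) * (A i k * B k i)) + (chi i - chi k) * (A' i k * B k i)).
ring.
Qed.

Fact glinf_c_linearr A : scalar (glinf_c A).
Proof.
move=> a B B'; have [m Am] := glinf_bound A; rewrite !(glinf_c_win _ Am (leqnn _)).
rewrite mulr_sumr -big_split; apply: eq_bigr => i _.
rewrite mulr_sumr -big_split; apply: eq_bigr => k _.
have -> : (a *: B + B') k i = a * B k i + B' k i by [].
rewrite -[RHS]/(a * ((chi i - chi k) * (A i k * B k i)) + (chi i - chi k) * (A i k * B' k i)).
ring.
Qed.

Fact glinf_cxx A : glinf_c A A = 0.
Proof.
have [m Am] := glinf_bound A; rewrite (glinf_c_win _ Am (leqnn _)).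
by apply: big_alternating => [i|i j]; [rewrite subrr mul0r | ring].
Qed.

Lemma glinf_c_mul_win n M A B C : (forall i j, (n < `|i - j|)%N -> A i j = 0) ->
  (forall i j, (n < `|i - j|)%N -> B i j = 0) -> (n + n <= M)%N ->
  glinf_c A (glinf_mul B C) =
  \sum_(i <- win M) \sum_(j <- win M) \sum_(k <- win M)
    (chi i - chi j) * (A i j * B j k * C k i).
Proof.
move=> An Bn nM; rewrite (@glinf_c_win n M) //; last by lia.
apply: eq_bigr => i _; apply: eq_bigr => j _.
under eq_bigr do rewrite -mulrA mulrA; rewrite -mulr_sumr mulrA.
have [/An ->|ij] := ltnP n `|i - j|; first by rewrite mulr0 !mul0r.
have [jn|jn] := leqP `|j| n; first by rewrite (@glinf_mul_win n M) //; lia.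
suff -> : chi i - chi j = 0 by rewrite !mul0r.
rewrite /chi; have -> : (i <= 0) = (j <= 0) by lia.
exact: subrr.
Qed.

Lemma glinf_c_brE A B C : glinf_c A [lie B, C] =
  glinf_c A (glinf_mul B C) - glinf_c A (glinf_mul C B).
Proof.
have := glinf_c_linearr A (-1) (glinf_mul C B) (glinf_mul B C).
by rewrite scaleN1r mulN1r addrC => <-; congr glinf_c; rewrite addrC.
Qed.

Fact glinf_c_jacobi A B C :
  glinf_c A [lie B, C] + glinf_c B [lie C, A] + glinf_c C [lie A, B] = 0.
Proof.
have cyc A' B' C' : glinf_c A' (glinf_mul B' C') + glinf_c B' (glinf_mul C' A') +
    glinf_c C' (glinf_mul A' B') = 0.
  have [a Aa] := glinf_bound A'; have [b Bb] := glinf_bound B'.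
  have [c Cc] := glinf_bound C'; pose n := (a + b + c)%N.
  have An i j : (n < `|i - j|)%N -> A' i j = 0 by move=> ij; apply: Aa; lia.
  have Bn i j : (n < `|i - j|)%N -> B' i j = 0 by move=> ij; apply: Bb; lia.
  have Cn i j : (n < `|i - j|)%N -> C' i j = 0 by move=> ij; apply: Cc; lia.
  rewrite !(@glinf_c_mul_win n (n + n)) //.
  by apply: big_cycle3 => i j k; ring.
rewrite !glinf_c_brE; have := cyc A B C; have := cyc A C B.
move=> h1 h2; rewrite -[RHS](subrr 0) -{1}h2 -h1; ring.
Qed.

Definition c_cocycle : cocycle2 (glinf K) :=
  Cocycle2 glinf_c_linearl glinf_c_linearr glinf_cxx glinf_c_jacobi.

Definition hat_glinf : lieAlgType K := central_ext c_cocycle.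

(* The entry (p, q) of the matrix unit E_(a, b). *)
Definition unitE (a b p q : int) : K := ((p == a) && (q == b))%:R.

(* The entry (p, q) of the image of t^m (x) e_ij; an index i : 'I_N stands for
   the index i.+1 in {1, ..., N}. *)
Definition iota_unit N (m : int) (i j : 'I_N) (p q : int) : K :=
  \sum_(k \in [set: int])
    unitE (N%:Z * (k - m) + i.+1%:Z) (N%:Z * k + j.+1%:Z) p q.

Definition iota_fun N (X : loop 'M[K]_N) (p q : int) : K :=
  \sum_(m \in [set: int]) \sum_(i < N) \sum_(j < N)
    X m i j * iota_unit m i j p q.

Fact iota_subproof N (X : loop 'M[K]_N) : (iota_fun X : int -> int -> K^o) \in @banded K.
Proof.
have [M XM] := loop_bound X; apply/asboolP; exists (N * M + N)%N => p q pq.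
rewrite /iota_fun fsbig1 // => m _; rewrite big1 // => i _; rewrite big1 // => j _.
have [/XM ->|mM] := ltnP M `|m|; first by rewrite mxE mul0r.
rewrite /iota_unit fsbig1 ?mulr0 // => k _; rewrite /unitE.
case: andP => // -[/eqP pE /eqP qE]; have iN := ltn_ord i; have jN := ltn_ord j.
have pqE : p - q = - (N%:Z * m) + (i%:Z - j%:Z) by rewrite pE qE; ring.
have : (absz (N%:Z * m)%R <= N * M)%N by rewrite abszM leq_mul.
lia.
Qed.

Definition iota_gl N (X : loop 'M[K]_N) : glinf K := GLinf (iota_subproof X).

End GLinf.

Definition Phi (K : fieldType) (g : finLieAlgType K) N (b : N.-tuple g)
  (X : loop g) : glinf K := iota_gl (loop_map (ad_mx b) X).

Definition hat_Phi (K : fieldType) (g : finLieAlgType K) N (b : N.-tuple g)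
  (z : hat_loop g) : hat_glinf K := (z.1, Phi b z.2).

(* Main.v *)
(** Write an index of a Z x Z matrix as N p + i with 1 <= i <= N.  In these block
    coordinates the image of X under iota_N is the block Toeplitz matrix whose
    block (p, q) is X_(q-p), so that matrix multiplication becomes convolution
    of Laurent families.  Since N p + i <= 0 iff p < 0, the cocycle c becomes
    sum_m (sum_p ([p < 0] - [p + m < 0])) tr(X_m Y_-m), and the inner sum is m.
    For X_m = ad x_m the trace is the Killing form, which gives u. *)
Require Import Defs.
From HB Require Import structures.
From mathcomp Require Import all_boot all_order all_algebra.
From mathcomp Require Import zify.
From mathcomp Require Import complex.
From mathcomp Require Import all_classical reals.

Set Implicit Arguments.
Unset Strict Implicit.
Unset Printing Implicit Defensive.

Import Order.TTheory GRing.Theory Num.Theory.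
Local Open Scope ring_scope.
Local Open Scope classical_set_scope.

(** * The adjoint representation as matrices in an arbitrary basis *)

Section AdjointMatrices.
Variables (K : fieldType) (g : finLieAlgType K) (N : nat) (b : N.-tuple g).
Hypothesis gb : basis_of {:g} b.

(** Needed because [killing] takes its trace in [vbasis], whereas [Phi] uses [b]. Expanding [b_i] in
    [b'] on one side and [f b'_k] in [b] on the other gives the same double sum. *)
Lemma mxtrace_end_mx_basis N' (b' : N'.-tuple g) (f : 'End(g)) :
  basis_of {:g} b' -> \tr (end_mx b f) = \tr (end_mx b' f).
Proof.
move=> gb'; rewrite /mxtrace.
transitivity (\sum_(i < N) \sum_(k < N') coord b' k b`_i * coord b i (f b'`_k)).
  apply: eq_bigr => i _; rewrite mxE {1}(coord_basis gb' (memvf b`_i)).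
  by rewrite !linear_sum; apply: eq_bigr => k _; rewrite !linearZ.
rewrite exchange_big; apply: eq_bigr => k _ /=.
rewrite mxE [in RHS](coord_basis gb (memvf (f b'`_k))) linear_sum.
by apply: eq_bigr => i _; rewrite linearZ mulrC.
Qed.

Lemma killing_ad_mx x y : killing x y = \tr (ad_mx b x *m ad_mx b y).
Proof.
by rewrite /ad_mx -end_mx_comp // (mxtrace_end_mx_basis _ (vbasisP {:g})).
Qed.

Lemma ad_mx_br x y :
  ad_mx b [lie x, y] = ad_mx b x *m ad_mx b y - ad_mx b y *m ad_mx b x.
Proof.
have adB : ad [lie x, y] = (ad x \o ad y)%VF - (ad y \o ad x)%VF.
  apply/lfunP=> w; rewrite add_lfunE opp_lfunE !comp_lfunE !lfunE /=.
  rewrite [LHS]lie_brC [lie_br x w]lie_brC linearN opprK.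
  by apply/esym/eqP; rewrite -subr_eq0 opprK lie_jacobi.
by rewrite /ad_mx adB linearB /= !end_mx_comp.
Qed.

End AdjointMatrices.

(** * Block coordinates on the integers *)

Definition block_pos N (p : int) (i : 'I_N) : int := N%:Z * p + i.+1%:Z.

Lemma block_pos_inj N (p q : int) (i j : 'I_N) :
  block_pos p i = block_pos q j -> p = q /\ i = j.
Proof.
rewrite /block_pos => e; have iN := ltn_ord i; have jN := ltn_ord j.
have pq : p = q.
  have [//|pq|pq] := ltgtP p q; nia.
by split=> //; apply: val_inj => /=; rewrite pq in e; lia.
Qed.

Lemma block_posP N (k : int) : (0 < N)%N -> exists p (i : 'I_N), k = block_pos p i.
Proof.
move=> N0; have NZ : N%:Z != 0 by lia.
have rN : (absz (modz (k - 1) N%:Z) < N)%N.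
  by have := ltz_mod (k - 1) NZ; have := modz_ge0 (k - 1) NZ; lia.
exists (divz (k - 1) N%:Z), (Ordinal rN); rewrite /block_pos /=.
have := divz_eq (k - 1) N%:Z; have := modz_ge0 (k - 1) NZ; lia.
Qed.

(** Block [-1] ends exactly at 0, so the cut in the cocycle falls between two blocks and splits
    none. *)
Lemma block_pos_le0 N (p : int) (i : 'I_N) : (block_pos p i <= 0) = (p < 0).
Proof.
rewrite /block_pos; have iN := ltn_ord i.
by apply/idP/idP => h; nia.
Qed.

Lemma fsumT_block (V : nmodType) N M (F : int -> V) : (0 < N)%N ->
  (forall p (i : 'I_N), (M < `|p|)%N -> F (block_pos p i) = 0) ->
  \sum_(k \in [set: int]) F k = \sum_(p <- win M) \sum_(i < N) F (block_pos p i).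
Proof.
move=> N0 F0; pose s := [seq block_pos p i | p <- win M, i <- enum 'I_N].
have us : uniq s.
  apply: allpairs_uniq; rewrite ?win_uniq ?enum_uniq // => -[p i] [q j] _ _ /=.
  by move/block_pos_inj => [-> ->].
transitivity (\sum_(k <- s | k \in [set: int]) F k); last first.
  under eq_bigl do rewrite in_setT.
  by rewrite big_allpairs_dep; apply: eq_bigr => p _; rewrite big_enum.
rewrite [RHS](bigfs _ us) ?set_mem_set // => k.
have [p [i ->]] := block_posP k N0 => _ ks; apply: F0; rewrite ltnNge -mem_win.
by apply: contra ks => pM; apply/allpairsP; exists (p, i); rewrite mem_enum.
Qed.

(** * Block Toeplitz form of the image of [iota_gl] *)

Section Iota.
Variables (K : fieldType) (N : nat).
Implicit Types X Y : loop 'M[K]_N.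

Lemma unitE_block a c p q (i j i' j' : 'I_N) :
  Defs.unitE K (N%:Z * a + i.+1%:Z) (N%:Z * c + j.+1%:Z) (block_pos p i') (block_pos q j') =
  [&& p == a, i' == i, q == c & j' == j]%:R.
Proof.
rewrite /Defs.unitE; congr (nat_of_bool _)%:R; apply/andP/and4P => [[/eqP e1 /eqP e2]|].
  have [-> ->] := @block_pos_inj N p a i' i e1.
  by have [-> ->] := @block_pos_inj N q c j' j e2.
by case=> /eqP-> /eqP-> /eqP-> /eqP->; split; exact/eqP.
Qed.

Lemma iota_unit_block m (i j i' j' : 'I_N) p q :
  iota_unit K m i j (block_pos p i') (block_pos q j') =
  [&& m == q - p, i == i' & j == j']%:R.
Proof.
(* The column index [N k + j] lies in block [k], so only [k = q] contributes. *)
rewrite /iota_unit (@fsumT_win _ `|q|) => [|k kq]; last first.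
  by rewrite unitE_block; case: and4P => // -[_ _ /eqP qk _]; lia.
rewrite (bigD1_seq q) ?mem_win ?win_uniq //= big1 => [|k kq]; last first.
  by rewrite unitE_block [q == k]eq_sym (negPf kq) !andbF.
rewrite addr0 unitE_block eqxx (eq_sym i) (eq_sym j) /=; congr (nat_of_bool (_ && _))%:R.
by apply/eqP/eqP; lia.
Qed.

Lemma iota_glE X p q (i j : 'I_N) :
  iota_gl X (block_pos p i) (block_pos q j) = X (q - p) i j.
Proof.
rewrite -[LHS]/(iota_fun X (block_pos p i) (block_pos q j)) /iota_fun.
rewrite (@fsumT_win _ `|q - p|) => [|m mqp]; last first.
  rewrite big1 // => i' _; rewrite big1 // => j' _; rewrite iota_unit_block.
  by case: eqP => [e|_]; rewrite ?mulr0 //; lia.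
rewrite (bigD1_seq (q - p)) ?mem_win ?win_uniq //= [X in _ + X]big1 => [|m mqp]; last first.
  rewrite big1 // => i' _; rewrite big1 // => j' _; rewrite iota_unit_block.
  by rewrite (negPf mqp) mulr0.
rewrite addr0 (bigD1 i) //= [X in _ + X]big1 => [|i' ii]; last first.
  by rewrite big1 // => j' _; rewrite iota_unit_block (negPf ii) andbF mulr0.
rewrite addr0 (bigD1 j) //= [X in _ + X]big1 => [|j' jj]; last first.
  by rewrite iota_unit_block (negPf jj) !andbF mulr0.
by rewrite addr0 iota_unit_block !eqxx mulr1.
Qed.

Lemma iota_gl_eq (A B : glinf K) : (0 < N)%N ->
  (forall p q (i j : 'I_N), A (block_pos p i) (block_pos q j) =
     B (block_pos p i) (block_pos q j)) -> A = B.
Proof.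
move=> N0 AB; apply: glinfP => k l.
by have [p [i ->]] := block_posP k N0; have [q [j ->]] := block_posP l N0.
Qed.

(** Summing over the middle index block by block gives the products [X_(r-p) Y_(q-r)]; the
    substitution [r = p + m] turns this into a convolution. *)
Lemma iota_gl_mulE X Y p q (i j : 'I_N) :
  glinf_mul (iota_gl X) (iota_gl Y) (block_pos p i) (block_pos q j) =
  (\sum_(m \in [set: int]) X m *m Y (q - p - m)) i j.
Proof.
have N0 : (0 < N)%N by exact: leq_ltn_trans (ltn_ord i).
have [m Xm] := loop_bound X.
rewrite -[LHS]/(glinf_mul_fun _ _ _ _) /glinf_mul_fun.
rewrite (@fsumT_block _ N (m + `|p|)) // => [|r l rm]; last first.
  by rewrite iota_glE Xm ?mxE ?mul0r //; lia.
transitivity (\sum_(r <- win (m + `|p|)) (X (r - p) *m Y (q - r)) i j).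
  by apply: eq_bigr => r _; rewrite mxE; apply: eq_bigr => l _; rewrite !iota_glE.
rewrite -summxE; congr (fun_of_matrix _ _ _).
transitivity (\sum_(r \in [set: int]) X (r - p) *m Y (q - r)).
  by rewrite (@fsumT_win _ (m + `|p|)) // => r rm; rewrite Xm ?mul0mx //; lia.
rewrite [RHS](@reindex_fsbigT _ _ _ _ _ (fun r => r - p)).
  by apply: eq_fsbigr => r _; congr (_ *m Y _); lia.
by exists (fun r => r + p) => r; lia.
Qed.

End Iota.

(** Without blocks there are no block coordinates, so [N = 0] is treated apart. *)
Lemma iota_glN0 (K : fieldType) N (X : loop 'M[K]_N) : N = 0%N -> iota_gl X = 0.
Proof.
move=> N0; apply: glinfP => p q; rewrite glinf0E -[LHS]/(iota_fun X p q) /iota_fun.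
by rewrite fsbig1 // => m _; rewrite big1 // => i _; have := ltn_ord i; lia.
Qed.

(** * Changes of index and counting in windows *)

Lemma fsumT_translate (V : nmodType) (F : int -> V) p :
  \sum_(q \in [set: int]) F q = \sum_(d \in [set: int]) F (d + p).
Proof.
rewrite (@reindex_fsbigT _ _ _ _ _ (fun d => d + p)) //.
by exists (fun q => q - p) => d; lia.
Qed.

Lemma fsumT_reflect (V : nmodType) (F : int -> V) p :
  \sum_(q \in [set: int]) F q = \sum_(d \in [set: int]) F (p - d).
Proof.
rewrite (@reindex_fsbigT _ _ _ _ _ (fun d => p - d)) //.
by exists (fun q => p - q) => d; lia.
Qed.

Lemma sum_win_block (V : nmodType) N n M (F : int -> V) : (0 < N)%N -> (n < M)%N ->
  (forall i, (n < `|i|)%N -> F i = 0) ->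
  \sum_(i <- win n) F i = \sum_(p <- win M) \sum_(l < N) F (block_pos p l).
Proof.
move=> N0 nM F0; rewrite -fsumT_win // (@fsumT_block _ N M) // => p i pM.
(* The strict bound [n < M] matters: block [-M-1] ends at [-N M], which is [-M] when [N = 1]. *)
by apply: F0; rewrite /block_pos; have := ltn_ord i; nia.
Qed.

(** The window starts at [-M], so it has [m + M] elements below [m]. *)
Lemma sum_win_lt (R : pzRingType) M (m : int) : (`|m| <= M)%N ->
  \sum_(p <- win M) (p < m)%R%:R = (m + M%:Z)%:~R :> R.
Proof.
move=> mM; rewrite /win big_map.
pose a := absz (m + M%:Z).
transitivity (\sum_(0 <= i < M.*2.+1) (i < a)%N%:R : R).
  rewrite /index_iota subn0; apply: eq_bigr => i _; congr (nat_of_bool _)%:R.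
  by rewrite /a; lia.
have aM : (a <= M.*2.+1)%N by rewrite /a; lia.
rewrite (big_cat_nat (leq0n a) aM) /= [X in _ + X]big_nat [X in _ + X]big1 => [|i]; last first.
  by case/andP=> ai _; rewrite ltnNge ai.
rewrite addr0 big_nat; under eq_bigr => i /andP[_ ia] do rewrite ia.
rewrite -big_nat sumr_const_nat subn0 -[LHS]/(a%:Z%:~R); congr (_%:~R).
by rewrite /a; lia.
Qed.

(** This is where the factor [i] of [u] arises: the two counts are [M] and [M - d]. *)
Lemma sum_win_jump (R : pzRingType) M (d : int) : (`|d| <= M)%N ->
  \sum_(p <- win M) ((p < 0)%R%:R - (d + p < 0)%R%:R) = d%:~R :> R.
Proof.
move=> dM; rewrite sumrB sum_win_lt //.
have -> : \sum_(p <- win M) (d + p < 0)%R%:R = \sum_(p <- win M) (p < - d)%R%:R :> R.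
  by apply: eq_bigr => p _; congr (nat_of_bool _)%:R; lia.
by rewrite sum_win_lt ?abszN // -intrB; congr (_%:~R); lia.
Qed.

(** * The cocycle on block Toeplitz matrices *)

Lemma glinf_c_iota (K : fieldType) N (X Y : loop 'M[K]_N) :
  glinf_c (iota_gl X) (iota_gl Y) =
  \sum_(m \in [set: int]) m%:~R * \tr (X m *m Y (- m)).
Proof.
have [N0|N0] := posnP N.
  rewrite (iota_glN0 X N0) (@glinf_c_win _ 0 0) // big1 => [|i _].
    rewrite fsbig1 // => m _; rewrite /mxtrace big1 ?mulr0 // => i _.
    by have := ltn_ord i; lia.
  by rewrite big1 // => k _; rewrite glinf0E mul0r mulr0.
have [n An] := glinf_bound (iota_gl X); have [m Xm] := loop_bound X.
(* [M] exceeds [n] for the passage to blocks, and exceeds [m] so that every jump from [p] to [p + d]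
   with [|d| <= m] that crosses 0 stays inside the window. *)
pose M := (n + m).+1; pose T d := \tr (X d *m Y (- d)).
have T0 d : (m < `|d|)%N -> T d = 0 by move=> /Xm Xd; rewrite /T Xd mul0mx mxtrace0.
have chiE p (i : 'I_N) : chi K (block_pos p i) = (p < 0)%R%:R.
  by rewrite /chi block_pos_le0.
(* Outside the band the entry vanishes; inside it, an index beyond [n] forces both indices to the
   same side of 0. *)
have G0 i k : (n < `|i|)%N || (n < `|k|)%N ->
    (chi K i - chi K k) * (iota_gl X i k * iota_gl Y k i) = 0.
  move=> ik; have [/An ->|ikn] := ltnP n `|i - k|; first by rewrite mul0r mulr0.
  suff -> : (chi K i - chi K k) = 0 by rewrite mul0r.
  by rewrite /chi; have -> : (i <= 0) = (k <= 0) by [lia]; rewrite subrr.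
rewrite (glinf_c_win _ An (leqnn n)) (@sum_win_block _ N n M) //; first last.
- by move=> i ni; rewrite big1 // => k _; rewrite G0 // ni.
- by rewrite /M; lia.
transitivity (\sum_(p <- win M) \sum_(q <- win M)
    ((p < 0)%R%:R - (q < 0)%R%:R) * T (q - p)).
  apply: eq_bigr => p _.
  rewrite (eq_bigr (fun i : 'I_N => \sum_(q <- win M) \sum_(j < N)
    ((p < 0)%R%:R - (q < 0)%R%:R) * (X (q - p) i j * Y (p - q) j i))) => [|i _].
    rewrite exchange_big; apply: eq_bigr => q _ /=.
    rewrite /T /mxtrace mulr_sumr; apply: eq_bigr => i _.
    by rewrite mxE mulr_sumr opprB.
  rewrite (@sum_win_block _ N n M) //; first last.
  - by move=> k nk; rewrite G0 // nk orbT.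
  - by rewrite /M; lia.
  apply: eq_bigr => q _; apply: eq_bigr => j _.
  by rewrite !chiE !iota_glE.
(* Substitute [q = p + d]. The sum over [q] first extends to all integers: for [|q| > M], either
   [T (q - p)] is zero or [p] and [q] have the same sign. The support of [T] then bounds [d]. *)
transitivity (\sum_(p <- win M) \sum_(d <- win m)
    ((p < 0)%R%:R - (d + p < 0)%R%:R) * T d).
  apply: eq_bigr => p _; rewrite -fsumT_win => [|q qM].
    rewrite (fsumT_translate _ p) (@fsumT_win _ m) => [|d dm].
      by apply: eq_bigr => d _; rewrite addrK.
    by rewrite addrK T0 // mulr0.
  have [/T0 ->|qp] := ltnP m `|q - p|; first by rewrite mulr0.
  by have -> : (p < 0) = (q < 0) by [rewrite /M in qM; lia]; rewrite subrr mul0r.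
rewrite exchange_big (@fsumT_win _ m) => [|d /T0]; last by rewrite /T => ->; rewrite mulr0.
rewrite [LHS]big_seq [RHS]big_seq; apply: eq_bigr => d; rewrite mem_win => dm.
by rewrite -mulr_suml sum_win_jump // /M; lia.
Qed.

(** * The extended adjoint representation and its lift to the central extensions *)

Section AdjointEmbedding.
Variables (K : fieldType) (g : finLieAlgType K) (N : nat) (b : N.-tuple g).
Hypothesis gb : basis_of {:g} b.
Implicit Types X Y : loop g.

Lemma PhiE X p q (i j : 'I_N) :
  Phi b X (block_pos p i) (block_pos q j) = ad_mx b (X (q - p)) i j.
Proof. by rewrite /Phi iota_glE. Qed.

Lemma c_Phi X Y : c_cocycle K (Phi b X) (Phi b Y) = u_cocycle g X Y.
Proof.
rewrite [LHS]glinf_c_iota; apply: eq_fsbigr => m _ /=.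
by rewrite (killing_ad_mx gb).
Qed.

Lemma Phi_linear : linear (Phi b).
Proof.
move=> a X Y; have [N0|N0] := posnP N.
  by rewrite /Phi !(iota_glN0 _ N0) scaler0 addr0.
apply: (iota_gl_eq N0) => p q i j.
rewrite glinfDE glinfZE !PhiE loopDE loopZE linearP.
by rewrite !mxE.
Qed.

Lemma Phi_br X Y : Phi b [lie X, Y] = [lie Phi b X, Phi b Y].
Proof.
have [N0|N0] := posnP N.
  by rewrite {2 3}/Phi !(iota_glN0 _ N0) lie_br0l /Phi iota_glN0.
apply: (iota_gl_eq N0) => p q i j; rewrite PhiE.
rewrite -[RHS]/(glinf_br (Phi b X) (Phi b Y) _ _) glinf_brE !iota_gl_mulE /=.
(* Reflecting the index of the second convolution pairs [X_k] with [Y_(q-p-k)] in both products, so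
   the summands become commutators. *)
rewrite [X in _ = _ - fun_of_matrix X _ _](fsumT_reflect _ (q - p)) /= /loop_br_fun.
have [m Xm] := loop_bound X.
rewrite !(@fsumT_win _ m) => [|k km|k km|k km]; first last.
- by rewrite Xm ?lie_br0l.
- by rewrite Xm ?linear0 ?mul0mx.
- by rewrite subKr Xm ?linear0 ?mulmx0.
rewrite linear_sum !summxE -sumrB; apply: eq_bigr => k _ /=.
by rewrite ad_mx_br // !mxE subKr.
Qed.

Lemma Phi_lie_hom : lie_hom (Phi b).
Proof. by split; [exact: Phi_linear | exact: Phi_br]. Qed.

Lemma hat_Phi_lie_hom : lie_hom (hat_Phi b : hat_loop g -> hat_glinf K).
Proof.
split=> [a z z'|z z']; apply: central_ext_eq => //=.
- exact: Phi_linear.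
(* The central coordinate of the bracket: this is exactly the equality of cocycles. *)
- by symmetry; exact: c_Phi.
- exact: Phi_br.
Qed.

End AdjointEmbedding.

Lemma central_ext_snd_lie_hom (K : fieldType) (L : lieAlgType K) (w : cocycle2 L) :
  lie_hom (snd : central_ext w -> L).
Proof. by []. Qed.

Theorem theorem3p2 (R : realType) (g : finLieAlgType R[i]) (gss : semisimple g)
    (b : (\dim {:g}).-tuple g) (gb : basis_of {:g} b) :
  is_pullback (hat_Phi b) (snd : hat_loop g -> loop g)
              (snd : hat_glinf R[i] -> glinf R[i]) (Phi b) /\
  forall X Y : loop g,
    c_cocycle R[i] (Phi b X) (Phi b Y) = u_cocycle g X Y /\
    u_cocycle g X Y =
      \sum_(i \in [set: int]) i%:~R * killing (X i) (Y (- i)).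
Proof.
split=> [|X Y]; last by split; [exact: c_Phi|].
split=> //.
- split; [exact: hat_Phi_lie_hom | exact: central_ext_snd_lie_hom].
- split; [exact: central_ext_snd_lie_hom | exact: Phi_lie_hom].
(* [hat_Phi] fixes the central coordinate, so [x] dictates that coordinate and [y] the loop part;
   [xy] settles the remaining component. *)
move=> x y xy; exists (x.1, y); split=> [|z [zx zy]].
  by split=> //; apply: central_ext_eq.
by apply: central_ext_eq; rewrite -?zx -?zy.
Qed.
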